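(* Let $f$ be a $C^2$ type-2 function with $f'(x)f(x)\gg\log(x)$. Then there is a constant $K\geqslant1$ such that, for any sequence $(\alpha_n)_{n\geqslant0}$ with $0\leqslant\alpha_n\leqslant1$ and $\alpha_n\sim Kf'(n)$, in the probability space $(\mathcal{S},(\alpha_n)_{n\geqslant0})$ it holds almost surely that $$ r_2(n;\omega)\asymp f'(n)f(n). $$
   Context: $\mathcal{S}$ denotes the set of infinite subsets of $\mathbb{Z}_{\geqslant 0}$. For $\omega\in\mathcal{S}$, $r(n;\omega)$ is the indicator of $n\in\omega$ and $r_2(n;\omega)=\sum_{k_1+k_2=n} r(k_1;\omega)r(k_2;\omega)$. Given $\alpha_n\in[0,1]$, $(\mathcal{S},(\alpha_n)_{n\geqslant 0})$ is the probability space on $\mathcal{S}$ with $\sigma$-algebra generated by the events $B^{(n)}=\{\omega: n\in\omega\}$, with $\Pr(B^{(n)})=\alpha_n$ and the $B^{(n)}$ mutually independent. A positive measurable function $g$ defined on some $[\beta,+\infty)$ is $O$-regularly varying if $g(\lambda x)\asymp g(x)$ for every $\lambda>0$. A type-2 function is a real differentiable function $f$ defined on some $[\alpha,+\infty)$ with $f(x)\to+\infty$, such that both $f$ and $f'$ are positive, monotonic and $O$-regularly varying, and $f'$ is bounded. $F\gg G$ means $\liminf F/G>0$; $F\asymp G$ means $F/G$ is bounded above and below by positive constants for large arguments. *)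

(* Defs.v *)
From HB Require Import structures.
From mathcomp Require Import all_boot all_order all_algebra finmap.
From mathcomp Require Import all_classical all_reals all_analysis.

Set Implicit Arguments.
Unset Strict Implicit.
Unset Printing Implicit Defensive.

Import Order.TTheory GRing.Theory Num.Theory.
Import numFieldNormedType.Exports.

Local Open Scope classical_set_scope.
Local Open Scope ring_scope.

Definition asymp (R : realType) (T : Type) (F : set_system T) (u v : T -> R) :=
  exists c C : R, [/\ 0 < c, 0 < C & \forall x \near F, c <= u x / v x <= C].

Definition gg (R : realType) (u v : R -> R) :=
  (0 < limf_einf (fun x => (u x / v x)%:E) +oo%R)%E.

(* A function defined on [b, +oo[ is represented by a total function, whose
   values to the left of b are irrelevant. *)
Definition O_regularly_varying (R : realType) (b : R) (g : R -> R) :=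
  [/\ forall x, b <= x -> 0 < g x,
      measurable_fun `[b, +oo[ g &
      forall l : R, 0 < l -> asymp +oo (fun x => g (l * x)) g].

Definition monotonic (R : realType) (b : R) (g : R -> R) :=
  {in `[b, +oo[ &, {homo g : x y / x <= y}} \/
  {in `[b, +oo[ &, {homo g : x y / x <= y >-> y <= x}}.

(* Derivability at a itself is two-sided.  This costs no generality: a function
   that is differentiable (resp. C^2) on [a, +oo[ in the one-sided sense at a
   has an extension to the whole line that is so in the two-sided sense. *)
Definition type2 (R : realType) (a : R) (f : R -> R) :=
  [/\ forall x, a <= x -> derivable f x 1,
      f x @[x --> +oo] --> +oo,
      [/\ forall x, a <= x -> 0 < f x, monotonic a f &
          O_regularly_varying a f],
      [/\ forall x, a <= x -> 0 < derive1 f x, monotonic a (derive1 f) &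
          O_regularly_varying a (derive1 f)] &
      [bounded derive1 f x | x in `[a, +oo[ ]].

Definition C2 (R : realType) (a : R) (f : R -> R) :=
  [/\ forall x, a <= x -> derivable f x 1,
      forall x, a <= x -> derivable (derive1 f) x 1 &
      {within `[a, +oo[, continuous (derive1n 2 f)}].

Definition infset := {w : set nat | infinite_set w}.

HB.instance Definition _ := gen_eqMixin infset.
HB.instance Definition _ := gen_choiceMixin infset.
HB.instance Definition _ :=
  isPointed.Build infset (exist _ [set: nat] infinite_nat).

Definition B (n : nat) : set infset := [set w | sval w n].

Definition Sspace := g_sigma_algebraType (range B).

Definition r (n : nat) (w : infset) : nat := n \in sval w.

Definition r2 (n : nat) (w : infset) : nat :=
  \sum_(k : 'I_n.+1 * 'I_n.+1 | (k.1 + k.2 == n)%N) (r k.1 w * r k.2 w)%N.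

Definition mutually_independent (d : measure_display) (T : measurableType d)
    (R : realType) (P : probability T R) (E : nat -> set T) :=
  forall J : {fset nat},
    P (\bigcap_(i in [set` J]) E i) = (\prod_(i <- J) P (E i))%E.

Definition product_law (R : realType) (alpha : nat -> R)
    (P : probability Sspace R) :=
  (forall n, P (B n) = (alpha n)%:E) /\ mutually_independent P B.

(* Main.v *)
Require Import Defs.
From mathcomp Require Import all_boot all_order all_algebra.
From mathcomp Require Import finmap.
From mathcomp Require Import all_classical all_reals all_analysis.
From mathcomp Require Import ring lra zify.
Import Order.TTheory GRing.Theory Num.Theory.
Import numFieldNormedType.Exports.
Local Open Scope classical_set_scope.
Local Open Scope ring_scope.

(* Write [X_n] for the number of [k < n / 2] with both [k] and [n - k] in [w]; then
   [X_n <= r2 n w <= 2 * X_n + 1], and [X_n] counts independent events.  Its mean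
   is [\sum_(k < n / 2) alpha_k * alpha_(n-k)].  Monotonicity and O-regular
   variation of [f'] make every [alpha_(n-k)] comparable to [K * f' n], while the
   mean value theorem makes [\sum_(k < n / 2) alpha_k] comparable to
   [K * f (n / 2)], hence to [K * f n].  The mean is therefore at least
   [c * K ^ 2 * (f' n * f n)], with [c] depending on [f] alone, and this is at
   least [8 * ln n] when [K] is large.  Chernoff bounds then make the two tail
   probabilities at most [n ^ -2], and Borel-Cantelli concludes. *)

(** * Chernoff bounds for counts of independent events *)

Lemma fine_probability_split {d : measure_display} {T : measurableType d}
    {R : realType} (P : probability T R) {A E : set T} :
  measurable A -> measurable E ->
  fine (P A) = fine (P (A `&` E)) + fine (P (A `\` E)).
Proof.
move=> mA mE; have mAE := measurableI _ _ mA mE; have mD := measurableD mA mE.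
rewrite -fineD ?fin_num_measure //; congr fine.
by rewrite (measureDI P mA mE) addeC.
Qed.

Section chernoff.
Context {d : measure_display} {T : measurableType d} {R : realType}.
Context (P : probability T R) {I : eqType} (E : I -> set T).
Context (mE : forall i, measurable (E i)).

Definition hits (s : seq I) (w : T) : R := \sum_(i <- s) (w \in E i)%:R.

(** Independence inside [D] in product form, without dividing by [P D], which may vanish.
    Quantifying over subsequences lets the property pass to tails in an induction. *)
Definition independent_along (D : set T) (s : seq I) :=
  forall s', subseq s' s ->
    fine (P (D `&` \big[setI/setT]_(i <- s') E i)) =
    fine (P D) * \prod_(i <- s') fine (P (E i)).

(** On [E i] the count grows by one, so the threshold left for the other events drops by [x],
    whatever the sign of [x]. *)
Lemma hits_cons i s x y :
  [set w | y <= x * hits (i :: s) w] =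
  ([set w | y - x <= x * hits s w] `&` E i) `|`
  ([set w | y <= x * hits s w] `\` E i).
Proof.
apply/seteqP; split => w /=; rewrite /hits big_cons.
- have [/set_mem Ew|/negP nEw] := boolP (w \in E i); rewrite ?mulr1n ?mulr0n => h.
    by left; split => //; lra.
  by right; split; [lra|move=> /mem_set].
- by case=> -[h Ew]; [rewrite mem_set //|rewrite memNset //];
    rewrite ?mulr1n ?mulr0n; lra.
Qed.

Lemma measurable_hits s x y : measurable [set w | y <= x * hits s w].
Proof.
elim: s y => [|i s IH] y.
  have [y0|y0] := leP y 0.
    rewrite [X in measurable X](_ : _ = setT) //.
    by apply/seteqP; split => // w _ /=; rewrite /hits big_nil; lra.
  rewrite [X in measurable X](_ : _ = set0) //.
  by apply/seteqP; split => // w /=; rewrite /hits big_nil; lra.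
rewrite hits_cons; apply: measurableU.
  exact: measurableI.
exact: measurableD.
Qed.

Lemma measurable_bigsetI (s : seq I) : measurable (\big[setI/setT]_(i <- s) E i).
Proof.
elim: s => [|i s IH]; first by rewrite big_nil.
by rewrite big_cons; apply: measurableI.
Qed.

(* Exponential Markov inequality, by conditioning on the events one at a time:
   both [D `&` E i] and [D `\` E i] stay independent of the remaining events. *)
Lemma chernoff_along (x : R) (s : seq I) (D : set T) (y : R) :
  measurable D -> independent_along D s ->
  fine (P (D `&` [set w | y <= x * hits s w])) <=
  fine (P D) * expR ((expR x - 1) * (\sum_(i <- s) fine (P (E i))) - y).
Proof.
elim: s D y => [|i s IH] D y mD indD.
  rewrite big_nil mulr0 sub0r.
  have [y0|y0] := leP y 0.
    rewrite (_ : [set w | _] = setT); last first.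
      by apply/seteqP; split => // w _ /=; rewrite /hits big_nil; lra.
    rewrite setIT ler_peMr ?fine_ge0 ?measure_ge0 //.
    by rewrite -expR0 ler_expR; lra.
  rewrite (_ : [set w | _] = set0); last first.
    by apply/seteqP; split => // w /=; rewrite /hits big_nil; lra.
  by rewrite setI0 measure0 /= mulr_ge0 ?fine_ge0 ?measure_ge0 ?expR_ge0.
set p := fine (P (E i)).
have sub0 s' : subseq s' s -> subseq s' (i :: s).
  by move=> h; apply: (subseq_trans h); exact: subseq_cons.
have DEi : fine (P (D `&` E i)) = fine (P D) * p.
  have := indD [:: i]; rewrite !big_seq1 => -> //.
  by rewrite sub1seq mem_head.
have DNi : fine (P (D `\` E i)) = fine (P D) * (1 - p).
  by have := fine_probability_split P mD (mE i); rewrite DEi; lra.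
have ind1 : independent_along (D `&` E i) s.
  move=> s' ss'; rewrite DEi -setIA.
  have := indD (i :: s'); rewrite !big_cons => ->; first by rewrite mulrA.
  by rewrite /= eqxx.
have ind2 : independent_along (D `\` E i) s.
  move=> s' ss'; rewrite DNi.
  have mI := measurable_bigsetI s'.
  have h1 := indD _ (sub0 _ ss').
  have h2 := ind1 _ ss'; rewrite DEi in h2.
  (* The part outside [E i] is the whole minus the part inside, and both of these are already known
     to factor. *)
  have := fine_probability_split P (measurableI _ _ mD mI) (mE i).
  rewrite setIAC in h2; rewrite h1 h2 => h3.
  have -> : (D `\` E i) `&` \big[setI/setT]_(j <- s') E j =
      (D `&` \big[setI/setT]_(j <- s') E j) `\` E i.
    by apply/seteqP; split => w /=; tauto.
  lra.
have {}IH1 := IH _ (y - x) (measurableI _ _ mD (mE i)) ind1.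
have {}IH2 := IH _ y (measurableD mD (mE i)) ind2.
rewrite DEi in IH1; rewrite DNi in IH2.
have mh := measurable_hits (i :: s) x y.
rewrite (fine_probability_split P (measurableI _ _ mD mh) (mE i)).
have -> : D `&` [set w | y <= x * hits (i :: s) w] `&` E i =
    (D `&` E i) `&` [set w | y - x <= x * hits s w].
  by rewrite hits_cons; apply/seteqP; split => w /=; tauto.
have -> : D `&` [set w | y <= x * hits (i :: s) w] `\` E i =
    (D `\` E i) `&` [set w | y <= x * hits s w].
  by rewrite hits_cons; apply/seteqP; split => w /=; tauto.
apply: le_trans (lerD IH1 IH2) _.
rewrite big_cons -/p.
set m := \sum_(j <- s) _.
have -> : (expR x - 1) * m - (y - x) = x + ((expR x - 1) * m - y) by ring.
have -> : (expR x - 1) * (p + m) - y = (expR x - 1) * p + ((expR x - 1) * m - y).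
  by ring.
rewrite (expRD x) (expRD (_ * p)); set e := expR (_ - y).
have e0 : 0 <= e by exact: expR_ge0.
have D0 : 0 <= fine (P D) by rewrite fine_ge0.
(* Averaging over [E i] gives the factor [1 + (expR x - 1) * p], at most
   [expR ((expR x - 1) * p)]. *)
have -> : fine (P D) * p * (expR x * e) + fine (P D) * (1 - p) * e =
          fine (P D) * ((1 + (expR x - 1) * p) * e) by ring.
by rewrite ler_wpM2l // ler_wpM2r // expR_ge1Dx.
Qed.

(** This is the case [D = setT]. A positive [x] bounds the upper tail and a negative [x] the lower
    one, so one statement serves both. *)
Lemma chernoff_hits (x : R) (s : seq I) (y : R) :
  (forall s', subseq s' s ->
    fine (P (\big[setI/setT]_(i <- s') E i)) = \prod_(i <- s') fine (P (E i))) ->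
  (P [set w | (y <= x * hits s w)%R] <=
   (expR ((expR x - 1) * (\sum_(i <- s) fine (P (E i))) - y)%R)%:E)%E.
Proof.
move=> ind; have := chernoff_along x s setT y measurableT.
rewrite setTI probability_setT /= mul1r => h.
rewrite -lee_fin fineK ?fin_num_measure // in h; last exact: measurable_hits.
by apply: h => s' ss'; rewrite setTI probability_setT mul1r ind.
Qed.

End chernoff.

(** * Borel-Cantelli with inverse-square bounds *)

Lemma borel_cantelli_inv_square {d : measure_display} {T : measurableType d}
    {R : realType} (P : probability T R) (A : nat -> set T) :
  (forall n, measurable (A n)) ->
  (\forall n \near \oo, (P (A n) <= (expR (- (2 * ln n%:R)))%:E)%E) ->
  {ae P, forall w, \forall n \near \oo, ~ A n w}.
Proof.
move=> mA [N _ hN].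
(* The shift puts every index where the hypothesis holds and gives [n.+2 <= n + M], so each
   probability is below a telescoping difference. *)
pose M := N.+2.
pose F n := A (n + M)%N.
have mF n : measurable (F n) by exact: mA.
have hF n : (P (F n) <= ((n.+1%:R)^-1 - (n.+2%:R)^-1)%:E)%E.
  apply: (le_trans (hN (n + M)%N _)); first by rewrite /M /=; lia.
  rewrite lee_fin.
  have n1 : 0 < n.+1%:R :> R by rewrite ltr0n.
  have n2 : n.+2%:R = n.+1%:R + 1 :> R by rewrite -natr1.
  have nM : n.+2%:R <= (n + M)%:R :> R by rewrite ler_nat /M; lia.
  have M0 : 0 < (n + M)%:R :> R by lra.
  rewrite expRN expRM_natl lnK ?posrE //.
  have -> : n.+1%:R^-1 - n.+2%:R^-1 = (n.+1%:R * n.+2%:R)^-1 :> R.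
    by rewrite n2; field; rewrite ?gt_eqF //; lra.
  rewrite lef_pV2 ?posrE ?mulr_gt0 ?exprn_gt0 // ?n2; nra.
have cvF : (\sum_(0 <= n <oo) P (F n) < +oo)%E.
  apply: (@le_lt_trans _ _ 1%E); last exact: ltry.
  apply: lime_le; first by apply: is_cvg_nneseries.
  apply: nearW => n.
  apply: (@le_trans _ _ (\sum_(0 <= k < n) ((k.+1%:R)^-1 - (k.+2%:R)^-1)%:E)%E).
    by apply: lee_sum.
  rewrite sumEFin lee_fin.
  have -> : \sum_(0 <= k < n) (k.+1%:R^-1 - k.+2%:R^-1) = 1 - n.+1%:R^-1 :> R.
    have := telescope_sumr (fun k => k.+1%:R^-1 : R) (leq0n n).
    rewrite /= invr1 => /(congr1 -%R); rewrite opprB -sumrN => <-.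
    by apply: eq_bigr => k _; rewrite opprB.
  by rewrite gerBl invr_ge0.
exists (lim_sup_set F); split.
- by apply: bigcap_measurable => // k _; apply: bigcup_measurable.
- exact: lim_sup_set_cvg0.
- move=> w /= nw n _.
  apply: contrapT => nF; apply: nw; exists (n + M)%N => // m /= nm Am.
  apply: nF; exists (m - M)%N; first by rewrite /=; lia.
  by rewrite /F subnK //; lia.
Qed.

(** * Representations of [n] as counts of independent pairs *)

(** Meant for [2 * i < n], where [n - i] is not truncated and differs from [i]. *)
Definition pairE (n i : nat) : set Sspace := B i `&` B (n - i).

Lemma measurable_B n : measurable (B n : set Sspace).
Proof. by apply: sub_sigma_algebra; exists n. Qed.

Lemma measurable_pairE n i : measurable (pairE n i).
Proof. by apply: measurableI; exact: measurable_B. Qed.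

Lemma mem_pairE n i (w : Sspace) : (w \in pairE n i) = (r i w * r (n - i) w)%N :> nat.
Proof.
rewrite /r mulnb; congr nat_of_bool; apply/idP/andP.
  by move=> /set_mem[h1 h2]; split; apply: mem_set.
by move=> [/set_mem h1 /set_mem h2]; apply/mem_set.
Qed.

Lemma r2E n w : r2 n w = (\sum_(0 <= k < n.+1) r k w * r (n - k) w)%N.
Proof.
rewrite /r2 -(pair_big_dep xpredT (fun i j : 'I_n.+1 => i + j == n)%N
  (fun i j : 'I_n.+1 => r i w * r j w)%N) big_mkord.
apply: eq_bigr => i _; rewrite (big_pred1 (rev_ord i)) /= ?subSS //.
move=> j /=; rewrite -(inj_eq val_inj) /= subSS.
have := ltn_ord i; have := ltn_ord j; lia.
Qed.

(* The pairs [(k, n - k)] with [2 k < n] and their mirror images exhaust the sum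
   [r2 n w], up to the diagonal pair when [n] is even. *)
Lemma r2_hits {R : realType} n w :
  hits (R := R) (pairE n) (iota 0 (uphalf n)) w <= (r2 n w)%:R
    <= 2 * hits (R := R) (pairE n) (iota 0 (uphalf n)) w + 1.
Proof.
set X := (\sum_(0 <= k < uphalf n) r k w * r (n - k) w)%N.
have -> : hits (pairE n) (iota 0 (uphalf n)) w = X%:R :> R.
  rewrite /hits /X natr_sum /index_iota subn0.
  by apply: eq_bigr => k _; rewrite mem_pairE.
have half : (uphalf n <= (n./2).+1 <= (uphalf n).+1)%N.
  by rewrite uphalf_half; case: (odd n); lia.
have odddouble := odd_double_half n.
(* Reversing the indices from [uphalf n] on turns them into the range [k <= n./2]. *)
have hr2 : r2 n w =
    (X + \sum_(0 <= k < (n./2).+1) r k w * r (n - k) w)%N.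
  rewrite r2E (@big_cat_nat _ _ _ (uphalf n)) //=; last by lia.
  congr addn; rewrite -{1}[uphalf n]add0n big_addn big_nat_rev /=.
  have -> : (n.+1 - uphalf n)%N = (n./2).+1.
    by rewrite uphalf_half; case: (odd n) odddouble; lia.
  apply: eq_big_nat => k kn.
  have e : (0 + (n./2).+1 - k.+1 + uphalf n = n - k)%N.
    by move: odddouble; rewrite uphalf_half; case: (odd n); lia.
  rewrite e mulnC; congr (r _ w * _)%N; lia.
(* For odd [n] this range is that of [X]; for even [n] it has one more term, which is at most 1. *)
have Y : (\sum_(0 <= k < (n./2).+1) r k w * r (n - k) w <= X + 1)%N.
  have [e|e] : ((n./2).+1 = uphalf n \/ n./2 = uphalf n)%N.
    by rewrite uphalf_half; case: (odd n); lia.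
  - by rewrite e -/X; lia.
  - by rewrite big_nat_recr //= e -/X leq_add2l /r; do 2 case: (_ \in _).
apply/andP; split; first by rewrite ler_nat hr2 leq_addr.
by rewrite -natrM natr1 ler_nat hr2; lia.
Qed.

(** Passes from finite sets to sequences; a repeated index would repeat its factor in the product
    but leave the intersection unchanged, hence [uniq]. *)
Lemma product_law_seq {R : realType} (alpha : nat -> R) (P : probability Sspace R) :
  product_law alpha P -> forall s : seq nat, uniq s ->
  P (\big[setI/setT]_(i <- s) B i) = (\prod_(i <- s) alpha i)%:E.
Proof.
move=> [PB indB] s us; have := indB [fset i in s]%fset.
have -> : \bigcap_(i in [set` [fset i in s]%fset]) (B i : set Sspace) =
    \big[setI/setT]_(i <- s) B i.
  rewrite -bigcap_seq; congr bigcap.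
  by apply/seteqP; split => i /=; rewrite !inE.
move=> ->.
have ps : perm_eq [fset i in s]%fset s.
  by apply: uniq_perm => // i; rewrite !inE.
rewrite (perm_big _ ps) /= -prodEFin.
by apply: eq_bigr => i _; rewrite PB.
Qed.

(** The indices [i] lie below [n / 2] and their reflections [n - i] above it, so all the [B k]
    involved are distinct. *)
Lemma pairE_independent {R : realType} (alpha : nat -> R) (P : probability Sspace R) n :
  product_law alpha P -> forall s : seq nat, subseq s (iota 0 (uphalf n)) ->
  P (\big[setI/setT]_(i <- s) pairE n i) =
    (\prod_(i <- s) (alpha i * alpha (n - i)%N))%:E.
Proof.
move=> Pa s ss.
have us : uniq s by apply: subseq_uniq ss (iota_uniq _ _).
have hs i : i \in s -> (i.*2 < n)%N.
  move=> /(mem_subseq ss); rewrite mem_iota add0n => /andP[_].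
  have := odd_double_half n; rewrite uphalf_half; lia.
have := product_law_seq _ _ Pa (s ++ map (subn n) s).
rewrite !big_cat /= !big_map !big_split /= => -> //.
rewrite cat_uniq us /=; apply/andP; split.
  apply/hasPn => j /mapP[i /hs hi ->]; apply/negP => /hs; lia.
rewrite map_inj_in_uniq // => i j /hs hi /hs hj; lia.
Qed.

(** * Asymptotic relations as eventual inequalities *)

Lemma gg_near {R : realType} {u v : R -> R} :
  gg u v -> exists2 e, 0 < e & \forall x \near +oo, e <= u x / v x.
Proof.
rewrite /gg limf_einfE => /ereal_sup_gt[_ [V Voo <-]].
case E : (ereal_inf _) => [e| |] // e0.
- exists e; first by rewrite lte_fin in e0.
  near=> x; rewrite -lee_fin -E; apply: ereal_inf_lbound; exists x => //.
  by near: x.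
(* An infinite infimum is absurd, since the quotient at any point of [V] is real; the witness 1 is
   arbitrary. *)
- exists 1 => //; near=> x.
  have : (+oo <= (u x / v x)%:E)%E.
    by rewrite -E; apply: ereal_inf_lbound; exists x => //; near: x.
  by rewrite leye_eq.
Unshelve. all: by end_near. Qed.

Lemma near_natr {R : realType} {p : R -> Prop} :
  (\forall x \near +oo, p x) -> \forall n \near \oo, p n%:R.
Proof. exact: cvgr_idn. Qed.

Lemma equiv_near {R : realType} {u v : nat -> R} :
  u ~_\oo v -> (\forall n \near \oo, 0 < v n) ->
  \forall n \near \oo, v n / 2 <= u n <= 2 * v n.
Proof.
move=> /eqaddoP uv v0; near=> n.
have vn : 0 < v n by near: n.
have : `|u n - v n| <= 2^-1 * `|v n|.
  by near: n; apply: (uv 2^-1); rewrite invr_gt0.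
rewrite ler_norml (gtr0_norm vn) => h; lra.
Unshelve. all: by end_near. Qed.

(** Treats both directions of monotonicity at once. *)
Lemma monotonic_between {R : realType} {b : R} {g : R -> R} (x y z : R) :
  monotonic b g -> b <= x -> x <= y <= z ->
  Num.min (g x) (g z) <= g y <= Num.max (g x) (g z).
Proof.
move=> mg bx /andP[xy yz].
have [xb yb zb] : [/\ x \in `[b, +oo[, y \in `[b, +oo[ & z \in `[b, +oo[].
  by split; rewrite in_itv /= andbT; lra.
by case: mg => h; rewrite ge_min le_max (h x y) // (h y z) ?orbT.
Qed.

(** * Growth of type-2 functions and sums of their derivatives *)

Section type2_function.
Context {R : realType} {a : R} {f : R -> R} (tf : type2 a f).
Local Notation g := (derive1 f).

Lemma type2_gt0 x : a <= x -> 0 < f x.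
Proof. by case: tf => _ _ [h _ _] _ _; exact: h. Qed.

Lemma type2_derive_gt0 x : a <= x -> 0 < g x.
Proof. by case: tf => _ _ _ [h _ _] _; exact: h. Qed.

Lemma type2_derive_monotonic : monotonic a g.
Proof. by case: tf => _ _ _ [_ h _] _. Qed.

Lemma type2_mean_value x y : a <= x -> x <= y ->
  exists2 c, x <= c <= y & f y - f x = g c * (y - x).
Proof.
move=> ax xy; have df z : a <= z -> derivable f z 1 by case: tf => h *; exact: h.
case: (@MVT_segment _ f g x y xy).
- move=> z; rewrite in_itv /= => zxy; rewrite derive1E.
  by apply: DeriveDef => //; apply: df; lra.
- apply: derivable_within_continuous => z; rewrite in_itv /= => zxy.
  by apply: df; lra.
- by move=> c; rewrite in_itv /= => cxy ->; exists c.
Qed.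

Lemma type2_le x y : a <= x -> x <= y -> f x <= f y.
Proof.
move=> ax xy; have [c cxy fxy] := type2_mean_value _ _ ax xy.
by rewrite -subr_ge0 fxy mulr_ge0 ?subr_ge0 // ltW // type2_derive_gt0; lra.
Qed.

Lemma type2_step x : a <= x ->
  Num.min (g x) (g (x + 1)) <= f (x + 1) - f x <= Num.max (g x) (g (x + 1)).
Proof.
move=> ax; have [|c cx ->] := @type2_mean_value x (x + 1) ax; first by lra.
rewrite [x + 1 - x]addrC addKr mulr1.
exact: monotonic_between type2_derive_monotonic _ _.
Qed.

(** [g k] is at most the increment of [f] after [k] if [g] increases, before [k] if it decreases;
    either way it is at most [f (k + 1) - f (k - 1)], which telescopes. The margin [a + 1] keeps
    [k - 1] in the domain. *)
Lemma type2_sum_derive_le (m N : nat) : a + 1 <= m%:R -> (m <= N)%N ->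
  \sum_(m <= k < N) g k%:R <= 2 * f N%:R.
Proof.
move=> am mN.
suff : \sum_(m <= k < N) g k%:R <= f N%:R + f (N%:R - 1) - f m%:R - f (m%:R - 1).
  have mN' : m%:R <= N%:R :> R by rewrite ler_nat.
  have := type2_le (N%:R - 1) N%:R; have := type2_gt0 m%:R.
  have := type2_gt0 (m%:R - 1) => h1 h2 h3 h4.
  have {}h1 : 0 < f (m%:R - 1) by apply: h1; lra.
  have {}h2 : 0 < f m%:R by apply: h2; lra.
  have {}h3 : f (N%:R - 1) <= f N%:R by apply: h3; lra.
  lra.
rewrite -(subnKC mN); elim: (N - m)%N => [|n IH].
  by rewrite addn0 big_geq //; lra.
rewrite addnS big_nat_recr ?leq_addr //=.
have nM : m%:R <= (m + n)%:R :> R by rewrite ler_nat leq_addr.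
rewrite -natr1 addrK; move: IH nM; set M : R := (m + n)%:R => IH nM.
have h1 : a <= M by lra.
have h2 : a <= M - 1 by lra.
have s1 := type2_step _ h1; have s2 := type2_step _ h2.
rewrite subrK in s2.
have ff : 0 <= f (M + 1) - f M by rewrite subr_ge0 type2_le //; lra.
have ff' : 0 <= f M - f (M - 1) by rewrite subr_ge0 type2_le //; lra.
have : g M <= f (M + 1) - f (M - 1).
  case: type2_derive_monotonic => mg.
  - have : g M <= g (M + 1) by apply: mg; rewrite ?in_itv /=; lra.
    by move: s1; rewrite ge_min => /andP[/orP[] ? _] ?; lra.
  - have : g M <= g (M - 1) by apply: mg; rewrite ?in_itv /=; lra.
    by move: s2; rewrite ge_min => /andP[/orP[] ? _] ?; lra.
lra.
Qed.

(** Here [g k] dominates the increment of [f] before [k] if [g] increases, after [k] if it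
    decreases. The two telescoped sums differ by unit shifts, and the stated bound is below both. *)
Lemma type2_sum_derive_ge (m N : nat) : a + 1 <= m%:R -> (m < N)%N ->
  f (N%:R - 1) - f m%:R <= \sum_(m <= k < N) g k%:R.
Proof.
move=> am mN.
have mN' : m.+1%:R <= N%:R :> R by rewrite ler_nat.
rewrite -natr1 in mN'.
have step (n : nat) : (m <= n)%N ->
    [/\ a + 1 <= n%:R, a <= n%:R & a <= n%:R - 1].
  by rewrite -(ler_nat R) => mn; split; lra.
case: type2_derive_monotonic => mg.
- suff : f (N%:R - 1) - f (m%:R - 1) <= \sum_(m <= k < N) g k%:R.
    have : f (m%:R - 1) <= f m%:R by apply: type2_le; lra.
    lra.
  rewrite -(subnKC (ltnW mN)); elim: (N - m)%N => [|n IH].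
    by rewrite addn0 big_geq //; lra.
  rewrite addnS big_nat_recr ?leq_addr //= -natr1 addrK.
  have [h1 h2 h3] := step (m + n)%N (leq_addr _ _).
  have := type2_step _ h3; rewrite subrK max_r; first by lra.
  by apply: mg; rewrite ?in_itv /=; lra.
- suff : f N%:R - f m%:R <= \sum_(m <= k < N) g k%:R.
    have : f (N%:R - 1) <= f N%:R by apply: type2_le; lra.
    lra.
  rewrite -(subnKC (ltnW mN)); elim: (N - m)%N => [|n IH].
    by rewrite addn0 big_geq //; lra.
  rewrite addnS big_nat_recr ?leq_addr //= -natr1.
  have [h1 h2 h3] := step (m + n)%N (leq_addr _ _).
  have := type2_step _ h2; rewrite max_l; first by lra.
  by apply: mg; rewrite ?in_itv /=; lra.
Qed.

(** By monotonicity [g m] lies between [g (n / 2)] and [g n], and O-regular variation compares these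
    two. The endpoint [g n] itself accounts for the minimum and maximum with 1. *)
Lemma type2_derive_half : exists c C : R, [/\ 0 < c, 0 < C &
  \forall n \near \oo, forall m : nat, (m <= n <= m.*2)%N ->
    c * g n%:R <= g m%:R <= C * g n%:R].
Proof.
have : asymp +oo (fun x => g (2^-1 * x)) g.
  by case: tf => _ _ _ [_ _ [_ _ h]] _; apply: h; rewrite invr_gt0.
move=> [c [C [c0 C0 /near_natr h]]].
exists (Num.min c 1), (Num.max C 1); split.
- by rewrite lt_min c0 /=.
- by rewrite lt_max C0.
near=> n => m /andP[mn nm].
have na : 2 * a <= n%:R by near: n; exact: nbhs_infty_ger.
have na' : a <= n%:R by near: n; exact: nbhs_infty_ger.
have gn : 0 < g n%:R by apply: type2_derive_gt0.
have : c <= g (2^-1 * n%:R) / g n%:R <= C by near: n.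
rewrite ler_pdivlMr // ler_pdivrMr // => /andP[h1 h2].
have nm' : n%:R <= 2 * m%:R :> R by rewrite -natrM ler_nat mul2n.
have := @monotonic_between _ _ _ (2^-1 * n%:R) m%:R n%:R type2_derive_monotonic.
rewrite ler_nat mn andbT => /(_ _ _)/andP[||]; [lra|lra|].
rewrite ge_min le_max => i1 i2; apply/andP; split.
- have [k1 k2] : Num.min c 1 * g n%:R <= c * g n%:R /\
      Num.min c 1 * g n%:R <= 1 * g n%:R.
    by rewrite !ler_pM2r // !ge_min !lexx ?orbT.
  by case/orP: i1; lra.
- have [k1 k2] : C * g n%:R <= Num.max C 1 * g n%:R /\
      1 * g n%:R <= Num.max C 1 * g n%:R.
    by rewrite !ler_pM2r // !le_max !lexx ?orbT.
  by case/orP: i2; lra.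
Unshelve. all: by end_near. Qed.

(** The ratio 1/4 leaves room for a unit loss: [uphalf n - 1 >= n / 4] once [n >= 4]. *)
Lemma type2_quarter : exists2 c : R, 0 < c &
  \forall n \near \oo, c * f n%:R <= f (4^-1 * n%:R).
Proof.
have : asymp +oo (fun x => f (4^-1 * x)) f.
  by case: tf => _ _ [_ _ [_ _ h]] _ _; apply: h; rewrite invr_gt0.
move=> [c [C [c0 C0 /near_natr h]]].
exists c => //; near=> n.
have na : a <= n%:R by near: n; exact: nbhs_infty_ger.
have : c <= f (4^-1 * n%:R) / f n%:R <= C by near: n.
by rewrite ler_pdivlMr ?type2_gt0 // => /andP[].
Unshelve. all: by end_near. Qed.

Lemma type2_near_ge (A : R) : \forall n \near \oo, A <= f n%:R.
Proof.
apply: (near_natr (p := fun x => A <= f x)).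
case: tf => _ foo _ _ _.
by have /cvgryPge := foo; exact.
Qed.

End type2_function.

(** * The mean number of pairs *)

(** The order of quantifiers matters: [c] is fixed before [K], so that a large [K] can raise the
    lower bound at will, while [C] may depend on [K]. *)
Lemma type2_convolution {R : realType} {a : R} {f : R -> R} : type2 a f ->
  exists2 c : R, 0 < c &
  forall (K : R) (alpha : nat -> R), 1 <= K -> (forall n, 0 <= alpha n <= 1) ->
  alpha ~_\oo (fun n => K * derive1 f n%:R) ->
  exists2 C : R, 0 < C & \forall n \near \oo,
    K ^+ 2 * c * (derive1 f n%:R * f n%:R) <=
      \sum_(i <- iota 0 (uphalf n)) alpha i * alpha (n - i)%N <=
    C * (derive1 f n%:R * f n%:R).
Proof.
move=> tf; set g := derive1 f.
have [cg [Cg [cg0 Cg0 hg]]] := type2_derive_half tf.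
have [cf cf0 hf] := type2_quarter tf.
(* The product of [K / 2 * cg] from [factor] and [K * cf / 4] from [SL], without [K ^+ 2]. *)
exists (cg * cf / 8); first by rewrite divr_gt0 ?mulr_gt0.
move=> K alpha K1 alpha01 aK.
have K0 : 0 < K by lra.
have [N _ hN] : \forall n \near \oo, K * g n%:R / 2 <= alpha n <= 2 * (K * g n%:R).
  apply: equiv_near => //; near=> n; rewrite mulr_gt0 // (type2_derive_gt0 tf) //.
  by near: n; exact: nbhs_infty_ger.
have [N' _ hN'] : \forall n \near \oo, a + 1 <= n%:R.
  exact: nbhs_infty_ger.
pose M := maxn N N'.
have aM : a + 1 <= M%:R by apply: hN'; rewrite /= leq_maxr.
have alphaM k : (M <= k)%N -> K * g k%:R / 2 <= alpha k <= 2 * (K * g k%:R).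
  by move=> Mk; apply: hN; rewrite /= (leq_trans _ Mk) // leq_maxl.
(* The product of [2 * K * Cg] from [factor] and [5 * K] from [SU]. *)
exists (10 * K ^+ 2 * Cg); first by rewrite !mulr_gt0 // exprn_gt0.
near=> n.
have nM : (M.*2.+4 <= n)%N by near: n; exact: nbhs_infty_ge.
set h := uphalf n.
have hn' : (h.*2 <= n.+1 <= h.*2.+1)%N.
  by rewrite /h; have := odd_double_half n; rewrite uphalf_half; lia.
have [Mh hn nh] : [/\ (M < h)%N, (h <= n)%N & (n <= 2 * h)%N].
  by clear -hn' nM; split; lia.
have tailn i : (i < h)%N -> (n - i <= n <= (n - i).*2)%N /\ (M <= n - i)%N.
  by clear -hn' nM; lia.
have [Mn n4N] : (M <= n)%N /\ (4 <= n)%N by clear -nM; lia.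
have gnm : forall m : nat, (m <= n <= m.*2)%N -> cg * g n%:R <= g m%:R <= Cg * g n%:R.
  by near: n.
have an : a <= n%:R.
  by have : M%:R <= n%:R :> R; [rewrite ler_nat|lra].
have gn0 : 0 < g n%:R by exact: (type2_derive_gt0 tf).
have fn0 : 0 < f n%:R by exact: (type2_gt0 tf).
set S := \sum_(0 <= i < h) alpha i.
have -> : \sum_(i <- iota 0 h) alpha i * alpha (n - i)%N =
    \sum_(0 <= i < h) alpha i * alpha (n - i)%N.
  by rewrite /index_iota subn0.
(* Since [n / 2 <= n - i <= n], each [alpha (n - i)] is comparable to [K * g n] and leaves the
   sum. *)
have factor : K / 2 * cg * g n%:R * S <=
    \sum_(0 <= i < h) alpha i * alpha (n - i)%N <= 2 * K * Cg * g n%:R * S.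
  have tail i : (i < h)%N ->
      K / 2 * cg * g n%:R <= alpha (n - i)%N <= 2 * K * Cg * g n%:R.
    move=> /tailn[n1 n2].
    have /andP[h1 h2] := gnm _ n1; have /andP[h3 h4] := alphaM _ n2.
    rewrite -(ler_pM2l K0) in h1; rewrite -(ler_pM2l K0) in h2.
    by apply/andP; split; lra.
  rewrite /S !mulr_sumr; apply/andP; split; apply: ler_sum_nat => i /andP[_ ih];
    have /andP[a0 _] := alpha01 i; have /andP[t1 t2] := tail i ih.
  - by rewrite mulrC ler_wpM2l.
  - by rewrite [leRHS]mulrC ler_wpM2l.
have split : S = \sum_(0 <= i < M) alpha i + \sum_(M <= i < h) alpha i.
  by rewrite /S (@big_cat_nat _ _ _ M) //= ltnW.
(* Before [M] only the bounds 0 and 1 are at hand; this constant contribution is absorbed because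
   [f] tends to infinity. *)
have S1 : 0 <= \sum_(0 <= i < M) alpha i <= M%:R.
  apply/andP; split.
    by apply: sumr_ge0 => i _; have /andP[] := alpha01 i.
  rewrite (le_trans (ler_sum_nat (G := fun=> 1) _)) //.
    by move=> i _; have /andP[] := alpha01 i.
  by rewrite sumr_const_nat subn0.
have S2 : K / 2 * \sum_(M <= i < h) g i%:R <= \sum_(M <= i < h) alpha i
    <= 2 * K * \sum_(M <= i < h) g i%:R.
  rewrite !mulr_sumr; apply/andP; split; apply: ler_sum_nat => i /andP[Mi _].
    by have := alphaM i Mi; lra.
  by have := alphaM i Mi; lra.
have T1 : \sum_(M <= i < h) g i%:R <= 2 * f n%:R.
  apply: le_trans (type2_sum_derive_le tf _ _ aM (ltnW Mh)) _.
  rewrite ler_pM2l //; apply: (type2_le tf).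
    by have : M%:R <= h%:R :> R; [rewrite ler_nat ltnW|lra].
  by rewrite ler_nat.
have T2 : cf / 2 * f n%:R <= \sum_(M <= i < h) g i%:R.
  apply: le_trans (type2_sum_derive_ge tf _ _ aM Mh).
  have nhR : n%:R <= 2 * h%:R :> R by rewrite -natrM ler_nat.
  have n4 : 4 <= n%:R :> R by rewrite ler_nat.
  have f4 : cf * f n%:R <= f (4^-1 * n%:R) by near: n.
  have n4a : 4 * a <= n%:R by near: n; exact: nbhs_infty_ger.
  have f4' : f (4^-1 * n%:R) <= f (h%:R - 1) by apply: (type2_le tf); lra.
  (* Half of [cf * f n] pays for the subtracted [f M]. *)
  have fA : f M%:R / (cf / 2) <= f n%:R by near: n; exact: type2_near_ge tf _.
  rewrite ler_pdivrMr ?divr_gt0 // in fA.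
  lra.
have fM : M%:R <= f n%:R by near: n; exact: type2_near_ge tf _.
have SL : K * cf / 4 * f n%:R <= S.
  have : K / 2 * (cf / 2 * f n%:R) <= K / 2 * \sum_(M <= i < h) g i%:R.
    by rewrite ler_pM2l // divr_gt0.
  lra.
(* The initial terms contribute at most [K * f n], the others at most [4 * K * f n]. *)
have SU : S <= 5 * K * f n%:R.
  have : 2 * K * \sum_(M <= i < h) g i%:R <= 2 * K * (2 * f n%:R).
    by rewrite ler_pM2l // mulr_gt0.
  have : 1 * f n%:R <= K * f n%:R by rewrite ler_pM2r.
  lra.
case/andP: factor => F1 F2; apply/andP; split.
- apply: le_trans F1.
  have := SL; rewrite -(ler_pM2l (x := K / 2 * cg * g n%:R)); last first.
    by rewrite !mulr_gt0.
  by apply: le_trans; lra.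
- apply: le_trans F2 _.
  have := SU; rewrite -(ler_pM2l (x := 2 * K * Cg * g n%:R)); last first.
    by rewrite !mulr_gt0.
  by move/le_trans; apply; lra.
Unshelve. all: by end_near. Qed.

(** * Choice of [K] and concentration around the mean *)

Theorem theorem3p14 (R : realType) (a : R) (f : R -> R) :
  type2 a f -> C2 a f ->
  gg (fun x => derive1 f x * f x) (fun x => ln x) ->
  exists K : R, 1 <= K /\
    forall alpha : nat -> R,
      (forall n, 0 <= alpha n <= 1) ->
      alpha ~_\oo (fun n => K * derive1 f n%:R) ->
      forall P : probability Sspace R, product_law alpha P ->
        {ae P, forall w, asymp \oo (fun n => (r2 n w)%:R)
                                   (fun n => derive1 f n%:R * f n%:R)}.
Proof.
move=> tf _ /gg_near[e e0 /near_natr he].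
have [c c0 hc] := type2_convolution tf.
(* As [K >= 1], this gives [K ^+ 2 * c * e >= 8], hence a mean of at least [8 * ln n]. *)
pose K := Num.max 1 (8 / (c * e)).
have K1 : 1 <= K by rewrite le_max lexx.
have K2 : 8 <= K ^+ 2 * c * e.
  have ce : 0 < c * e by rewrite mulr_gt0.
  have : 8 / (c * e) <= K by rewrite le_max lexx orbT.
  rewrite ler_pdivrMr // => h.
  have : K * (c * e) <= K * (K * (c * e)).
    by rewrite ler_peMl // mulr_ge0 //; [lra|exact: ltW].
  rewrite expr2; lra.
exists K; split => // alpha alpha01 aK P Pa.
have [C C0 hC] := hc K alpha K1 alpha01 aK.
pose mu n := \sum_(i <- iota 0 (uphalf n)) alpha i * alpha (n - i)%N.
pose X n (w : Sspace) : R := hits (pairE n) (iota 0 (uphalf n)) w.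
have Ppair n i : i \in iota 0 (uphalf n) ->
    fine (P (pairE n i)) = alpha i * alpha (n - i)%N.
  move=> hi; have := pairE_independent _ _ n Pa [:: i].
  by rewrite sub1seq hi !big_seq1 => -> //.
have tail x y n : (P [set w | (y <= x * X n w)%R] <=
    (expR ((expR x - 1) * mu n - y)%R)%:E)%E.
  have -> : mu n = \sum_(i <- iota 0 (uphalf n)) fine (P (pairE n i)).
    by apply: eq_big_seq => i /Ppair ->.
  apply: (chernoff_hits P (pairE n) (measurable_pairE n)).
  move=> s ss; rewrite (pairE_independent _ _ _ Pa _ ss) /=.
  by apply: eq_big_seq => i /(mem_subseq ss)/Ppair ->.
(* The first bound, valid once [ln n >= 1], later absorbs the [+ 1] of [r2_hits]. *)
pose good n := [/\ e <= derive1 f n%:R * f n%:R,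
    8 * ln n%:R <= mu n & K ^+ 2 * c * (derive1 f n%:R * f n%:R) <= mu n
      <= C * (derive1 f n%:R * f n%:R)].
have large : \forall n \near \oo, good n.
  near=> n.
  have ln1 : 1 <= ln n%:R :> R.
    rewrite -[leLHS]expRK ler_ln ?posrE ?expR_gt0 //; last first.
      by near: n; exact: nbhs_infty_gtr.
    by near: n; exact: nbhs_infty_ger.
  have : e <= derive1 f n%:R * f n%:R / ln n%:R by near: n.
  rewrite ler_pdivlMr; last by lra.
  move=> h1.
  have h2 : K ^+ 2 * c * (derive1 f n%:R * f n%:R) <= mu n
      <= C * (derive1 f n%:R * f n%:R) by near: n.
  have h3 : e * 1 <= e * ln n%:R by rewrite ler_pM2l.
  split => //; first by lra.
  have Kc : 0 < K ^+ 2 * c by rewrite mulr_gt0 // exprn_gt0 //; lra.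
  rewrite -(ler_pM2l Kc) in h1.
  have : 8 * ln n%:R <= K ^+ 2 * c * e * ln n%:R by rewrite ler_wpM2r //; lra.
  lra.
(* With [x = 1] and [y = expR 1 * mu n] the Chernoff exponent is exactly [- mu n]. *)
have upper : {ae P, forall w, \forall n \near \oo, ~ (expR 1 * mu n <= 1 * X n w)}.
  apply: borel_cantelli_inv_square.
    by move=> n; apply: measurable_hits; exact: measurable_pairE.
  near=> n; apply: le_trans (tail _ _ _) _; rewrite lee_fin ler_expR.
  have [_ h _] : good n by near: n.
  have : 0 <= ln n%:R :> R.
    by apply: ln_ge0; near: n; exact: nbhs_infty_ger.
  lra.
(* With [x = -1] and [y = - mu n / 4] the exponent is at most [- mu n / 4], because
   [expR (- 1) <= 1 / 2]; the factor 8 makes this at most [- 2 * ln n]. *)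
have lower : {ae P, forall w, \forall n \near \oo, ~ (- (mu n / 4) <= -1 * X n w)}.
  apply: borel_cantelli_inv_square.
    by move=> n; apply: measurable_hits; exact: measurable_pairE.
  near=> n; apply: le_trans (tail _ _ _) _; rewrite lee_fin ler_expR.
  have [_ h _] : good n by near: n.
  have l0 : 0 <= ln n%:R :> R.
    by apply: ln_ge0; near: n; exact: nbhs_infty_ger.
  have e2 : expR (- 1) <= 2^-1 :> R.
    rewrite expRN lef_pV2 ?posrE ?expR_gt0 //.
    by have := @expR_ge1Dx R 1; lra.
  have : expR (- 1) * mu n <= 2^-1 * mu n by rewrite ler_wpM2r //; lra.
  lra.
apply: filterS2 upper lower => w up lo.
(* From [mu n / 4 < X n w < expR 1 * mu n]; the term [e^-1], with [e] the constant from [gg_near],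
   covers the diagonal pair. *)
exists (K ^+ 2 * c / 4), (2 * expR 1 * C + e^-1); split.
- by rewrite divr_gt0 // mulr_gt0 // exprn_gt0 //; lra.
- by rewrite addr_gt0 ?invr_gt0 // !mulr_gt0 ?expR_gt0.
near=> n.
have [he1 _ /andP[h1 h2]] : good n by near: n.
have gf0 : 0 < derive1 f n%:R * f n%:R by lra.
have /negP : ~ (expR 1 * mu n <= 1 * X n w) by near: n.
rewrite -ltNge mul1r => up1.
have /negP : ~ (- (mu n / 4) <= -1 * X n w) by near: n.
rewrite -ltNge => lo1.
have /andP[r1 r2'] := r2_hits (R := R) n w.
rewrite -/(X n w) in r1 r2'.
rewrite ler_pdivlMr // ler_pdivrMr //; apply/andP; split; first by lra.
have h3 : expR 1 * mu n <= expR 1 * (C * (derive1 f n%:R * f n%:R)).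
  by rewrite ler_pM2l // expR_gt0.
have h4 : 1 <= e^-1 * (derive1 f n%:R * f n%:R).
  by rewrite -ler_pdivrMl ?invr_gt0 // invrK mulr1.
lra.
Unshelve. all: by end_near. Qed.
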